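(* Let $G=(V,E)$ be an $n$-vertex graph and let $\hat E$ be the random set of edges obtained by independently sampling each edge $e\in E$ with probability $p_e=\min\{50\log^2 n/rd(e),\,1\}$. Let $cg[G,\hat E]$ be the component graph induced by $\hat E$. Then with probability at least $1-\frac1n$: (1) the number of sampled edges is $|\hat E|=O(n\log^2 n)$; and (2) the number of inter-component edges, that is, the number of edges of $cg[G,\hat E]$, is $O(n)$.
   Context: $G$ is undirected and $\log$ is the base-2 logarithm. The rounded-degree of a (non-isolated) vertex $u$ is $rd(u)=2^{\lfloor \log \mathrm{degree}(u)\rfloor}$, and the rounded-degree of an edge $e=\{u,v\}$ is $rd(e)=\min\{rd(u),rd(v)\}$, with degrees taken in $G$. For $\hat E\subseteq E$, let $\mathcal C$ be the set of connected components of $(V,\hat E)$. The component graph $cg[G,\hat E]$ is the (simple) graph with vertex set $\mathcal C$ in which two distinct components $C_i,C_j$ are adjacent if and only if there is an edge $\{u,v\}\in E$ with $u\in C_i$ and $v\in C_j$; its edges are called inter-component edges. The constants hidden in $O(\cdot)$ are absolute. *)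

(* Defs.v *)
From mathcomp Require Import all_boot all_order all_algebra.
From mathcomp Require Import reals exp.

Set Implicit Arguments.
Unset Strict Implicit.
Unset Printing Implicit Defensive.

Import Order.TTheory GRing.Theory Num.Theory.

Local Open Scope ring_scope.

Definition log2 (R : realType) (x : R) : R := ln x / ln 2.

(** A simple graph is a symmetric irreflexive relation [adj] on a finite type;
    an edge is the two-element set of its endpoints. *)

Definition edges (V : finType) (adj : rel V) : {set {set V}} :=
  [set [set uv.1; uv.2] | uv : V * V & adj uv.1 uv.2].

Definition degree (V : finType) (adj : rel V) (u : V) : nat :=
  #|[set v | adj u v]|.

(** [trunc_log 2 d] is the floor of the base-2 logarithm of [d > 0]; see
    [rdegree_floor] below. *)
Definition rdegree (V : finType) (adj : rel V) (u : V) : nat :=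
  (2 ^ trunc_log 2 (degree adj u))%N.

(** The default value [#|V|] is at least the rounded degree of every
    non-isolated vertex, so it plays no role on an edge; see [redge_pair] below. *)
Definition redge (V : finType) (adj : rel V) (e : {set V}) : nat :=
  \big[minn/#|V|]_(u in e) rdegree adj u.

Definition sample_rate (R : realType) (V : finType) (adj : rel V)
    (e : {set V}) : R :=
  Num.min (50 * log2 (#|V|%:R : R) ^+ 2 / (redge adj e)%:R) 1.

(** Probability of the event [A] for the random subset of [E] that contains
    each [e \in E] independently with probability [p e]. *)
Definition sampleP (R : realType) (X : finType) (E : {set X}) (p : X -> R)
    (A : pred {set X}) : R :=
  \sum_(S : {set X} | (S \subset E) && A S)
    (\prod_(e in S) p e) * (\prod_(e in E :\: S) (1 - p e)).

Definition components (V : finType) (S : {set {set V}}) : {set {set V}} :=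
  equivalence_partition (connect [rel u v | [set u; v] \in S]) [set: V].

(** Adjacency of the component graph, as a relation on [{set V}] supported on
    the components of [S]. *)
Definition cg (V : finType) (adj : rel V) (S : {set {set V}}) : rel {set V} :=
  [rel C D | [&& C \in components S, D \in components S, C != D &
              [exists u in C, exists v in D, adj u v]]].

Lemma rdegree_floor (R : realType) (V : finType) (adj : rel V) (u : V) :
  (0 < degree adj u)%N ->
  (rdegree adj u)%:R = 2 ^ Num.floor (log2 ((degree adj u)%:R : R)) :> R.
Proof.
move=> d_gt0; rewrite /rdegree.
set d := degree adj u in d_gt0 *; set k := trunc_log 2 d.
have ln2 : 0 < ln (2 : R) by rewrite ln_gt0 // ltr1n.
have /andP[lo hi] : (2 ^ k <= d < 2 ^ k.+1)%N by exact: trunc_log_bounds.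
suff -> : Num.floor (log2 (d%:R : R)) = k%:Z by rewrite natrX.
have dR : 0 < d%:R :> R by rewrite ltr0n.
have pow j : 0 < (2 ^ j)%:R :> R by rewrite ltr0n expn_gt0.
have lnpow j : ln ((2 ^ j)%:R : R) = j%:R * ln 2.
  by rewrite natrX lnXn ?mulr_natl.
apply/eqP; rewrite floor_eq; apply/andP; split.
  rewrite /log2 ler_pdivlMr //= -lnpow ler_ln ?posrE // ler_nat //.
rewrite /log2 ltr_pdivrMr // -PoszD addn1 -pmulrn -lnpow ltr_ln ?posrE //.
by rewrite ltr_nat.
Qed.

Lemma redge_pair (V : finType) (adj : rel V) (u v : V) :
  symmetric adj -> adj u v ->
  redge adj [set u; v] = minn (rdegree adj u) (rdegree adj v).
Proof.
move=> sym uv.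
have le x y : adj x y -> (rdegree adj x <= #|V|)%N.
  move=> xy; apply: leq_trans (max_card (mem [set z | adj x z])).
  by apply: trunc_logP => //; apply/card_gt0P; exists y; rewrite inE.
rewrite /redge -minEnat bigminU !bigmin_set1 minEnat.
by rewrite (minn_idPl (le u v _)) // (minn_idPl (le v u _)) // sym.
Qed.

(** The edges of any [F \subset E] are jointly sampled with the product of
    their probabilities. *)
Lemma sampleP_independent (R : realType) (X : finType) (E F : {set X})
    (p : X -> R) :
  F \subset E ->
  sampleP E p [pred S : {set X} | F \subset S] = \prod_(e in F) p e.
Proof.
move=> FE.
pose a x := if x \in E then p x else 0.
pose b x := if x \in E then (if x \in F then 0 else 1 - p x) else 1.
transitivity (\prod_x (a x + b x)).
  rewrite bigA_distr /sampleP big_mkcond /=; apply: eq_bigr => S _.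
  have [SE /=|/subsetPn[x xS xE]] := boolP (S \subset E); last first.
    by rewrite [RHS](bigD1 x) //= xS /a (negPf xE) mul0r.
  have [FS /=|/subsetPn[x xF xS]] := boolP (F \subset S); last first.
    by rewrite [RHS](bigD1 x) //= (negPf xS) /b xF (subsetP FE _ xF) mul0r.
  rewrite big_mkcond [X in _ * X]big_mkcond -big_split /=.
  apply: eq_bigr => x _; rewrite !inE /a /b.
  have [xS|xS] := boolP (x \in S); first by rewrite /= (subsetP SE _ xS) mulr1.
  rewrite mul1r /=; case: ifP => // xE; case: ifP => // xF.
  by rewrite (subsetP FS _ xF) in xS.
rewrite [RHS]big_mkcond /=; apply: eq_bigr => x _; rewrite /a /b.
case: ifP => [xE|xE]; first by case: ifP => _; rewrite ?addr0 // addrC subrK.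
case: ifP => xF; last by rewrite add0r.
by rewrite (subsetP FE _ xF) in xE.
Qed.

(* Main.v *)
Require Import Defs.
From mathcomp Require Import all_boot all_order all_algebra.
From mathcomp Require Import reals exp.
From mathcomp Require Import sequences ring lra zify.

(** Reveal the sample as the union of [floor (log n)] weak samples, each of rate
    [min (25 log n / rd e) 1], followed by one of rate
    [min (25 (log n)^2 / rd e) 1]; both failure events of claim (2) are
    decreasing, so it suffices to treat this sparser sample.

    With [K = 25 log n], after [r] weak samples every vertex [x] lies, with high
    probability, in a component of size at least [min (2^r) (degree x / K)].
    Indeed, if all vertices satisfy this at stage [r] and [x] has too small a
    component for stage [r + 1], then flipping an edge from [x] to a vertex [w]
    outside its component either joins a component so large that [x] is done, or
    succeeds with probability at least the inverse of the size of the component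
    of [w]; so the expected gain per flip is at least one vertex, as long as
    [x] is not done, and about [degree x] flips are available.

    After the weak samples, [degree x <= K |C|] for every [x] in a component [C].
    Give a component the maximum of [rd] over its vertices as weight; the total
    weight is then at most [K n], and an edge [e] that merges two components
    lowers it by at least [rd e].  As [e] is present with probability
    [25 (log n)^2 / rd e] in the last sample, the number of edges that fail to
    merge two components is of the order of [K n / (log n)^2], up to an
    exponentially small probability. *)

Set Implicit Arguments.
Unset Strict Implicit.
Unset Printing Implicit Defensive.

Import Order.TTheory GRing.Theory Num.Theory.

Local Open Scope ring_scope.

(** * Expectations over independent samples *)

Lemma set_ind (X : finType) (P : {set X} -> Prop) :
  P set0 -> (forall e (E : {set X}), e \notin E -> P E -> P (e |: E)) -> forall E, P E.
Proof.
move=> P0 PU E; have [n] := ubnP #|E|; elim: n E => // n IHn E leEn.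
have [->//|[e eE]] := set_0Vmem E.
rewrite -(setD1K eE); apply: PU; first by rewrite !inE eqxx.
by apply: IHn; move: leEn; rewrite [in X in (X < _)%N -> _](cardsD1 e) eE.
Qed.

Definition sampleE (R : realType) (X : finType) (E : {set X}) (p : X -> R)
    (f : {set X} -> R) : R :=
  \sum_(S : {set X} | S \subset E)
    (\prod_(e in S) p e) * (\prod_(e in E :\: S) (1 - p e)) * f S.

Lemma sampleP_sampleE (R : realType) (X : finType) (E : {set X}) (p : X -> R)
    (A : pred {set X}) :
  sampleP E p A = sampleE E p (fun S => (A S)%:R).
Proof.
rewrite /sampleP /sampleE big_mkcondr /=; apply: eq_bigr => S _.
by case: (A S); rewrite ?mulr1 ?mulr0.
Qed.

Section Expectation.
Variables (R : realType) (X : finType).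
Implicit Types (E S : {set X}) (p q : X -> R) (f g : {set X} -> R).

Lemma sampleE_set0 p f : sampleE set0 p f = f set0.
Proof.
rewrite /sampleE (eq_bigl (pred1 set0)) => [|S]; last by rewrite subset0.
by rewrite big_pred1_eq set0D !big_set0 !mul1r.
Qed.

(** Conditioning on whether [e] is sampled; every later induction reveals one edge at a time through
    this identity. *)
Lemma sampleE_setU1 E p f e : e \notin E ->
  sampleE (e |: E) p f =
    p e * sampleE E p (fun S => f (e |: S)) + (1 - p e) * sampleE E p f.
Proof.
move=> eE; rewrite /sampleE (bigID (fun S => e \in S)) /=; congr (_ + _).
  rewrite (reindex_onto (fun S => e |: S) (fun S => S :\ e)) /=; last first.
    by move=> S /andP[_ eS]; rewrite setD1K.
  rewrite mulr_sumr; apply: eq_big => S.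
    apply/idP/idP => [/andP[/andP[sub _] /eqP eSS]|SE].
      have eS : e \notin S by rewrite -eSS !inE eqxx.
      apply/subsetP => x xS; have /setU1P[xe|//] := subsetP sub x (setU1r e xS).
      by rewrite -xe xS in eS.
    have eS : e \notin S by apply: contra eE => /(subsetP SE).
    by rewrite setUS //= setU11 setU1K // eqxx.
  move=> /andP[/andP[sub _] /eqP eSS].
  have eS : e \notin S by rewrite -eSS !inE eqxx.
  rewrite big_setU1 //= -!mulrA; congr (_ * (_ * (_ * _))).
  apply: eq_bigl => x; rewrite !inE negb_or.
  by case: eqP => [->|//]; rewrite (negPf eE) andbF.
rewrite mulr_sumr; apply: eq_big => S.
  apply/andP/idP => [[sub eS]|SE].
    apply/subsetP => x xS; have /setU1P[xe|//] := subsetP sub x xS.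
    by rewrite -xe xS in eS.
  split; last by apply: contra eE => /(subsetP SE).
  by apply: subset_trans SE _; apply: subsetUr.
move=> /andP[_ eS]; rewrite setDUl.
have -> : [set e] :\: S = [set e].
  by apply/setP => x; rewrite !inE; case: eqP => [->|]; rewrite ?andbF ?eS.
by rewrite big_setU1 /= ?inE ?negb_and ?eE ?orbT //; ring.
Qed.

Lemma sampleE_cst E p c : sampleE E p (fun=> c) = c.
Proof.
by elim/set_ind: E => [|e E eE IH]; rewrite ?sampleE_set0 // sampleE_setU1 // IH; ring.
Qed.

Lemma sampleED E p f g : sampleE E p (fun S => f S + g S) = sampleE E p f + sampleE E p g.
Proof. by rewrite /sampleE -big_split /=; apply: eq_bigr => S _; rewrite mulrDr. Qed.

Lemma sampleEZ E p c f : sampleE E p (fun S => c * f S) = c * sampleE E p f.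
Proof. by rewrite /sampleE mulr_sumr; apply: eq_bigr => S _; rewrite mulrCA. Qed.

Lemma sampleE_sum (I : finType) E p (F : I -> {set X} -> R) :
  sampleE E p (fun S => \sum_i F i S) = \sum_i sampleE E p (F i).
Proof.
rewrite /sampleE exchange_big /=; apply: eq_bigr => S _; by rewrite mulr_sumr.
Qed.

Lemma eq_sampleE E p q f g :
  p =1 q -> (forall S, S \subset E -> f S = g S) -> sampleE E p f = sampleE E q g.
Proof.
move=> pq fg; apply: eq_bigr => S SE; rewrite fg //; congr (_ * _ * _).
  exact: eq_bigr.
by apply: eq_bigr => e _; rewrite pq.
Qed.

Lemma le_sampleE E p f g : (forall e, 0 <= p e <= 1) ->
  (forall S, S \subset E -> f S <= g S) -> sampleE E p f <= sampleE E p g.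
Proof.
move=> p01 fg; apply: ler_sum => S SE; apply: ler_wpM2l (fg S SE).
apply: mulr_ge0; apply: prodr_ge0 => e _; first by case/andP: (p01 e).
by rewrite subr_ge0; case/andP: (p01 e).
Qed.

(** The union misses an edge exactly when both samples miss it. This is what allows a sample to be
    revealed in rounds. *)
Lemma sampleE_setU E p q f :
  sampleE E p (fun S => sampleE E q (fun S' => f (S :|: S'))) =
  sampleE E (fun e => 1 - (1 - p e) * (1 - q e)) f.
Proof.
elim/set_ind: E f => [|e E eE IH] f; first by rewrite !sampleE_set0 setU0.
rewrite !sampleE_setU1 // -!IH.
have UE (g : {set X} -> {set X} -> R) :
  sampleE E p (fun S => sampleE (e |: E) q (g S)) =
    q e * sampleE E p (fun S => sampleE E q (fun S' => g S (e |: S'))) +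
    (1 - q e) * sampleE E p (fun S => sampleE E q (g S)).
  by rewrite -!sampleEZ -sampleED; apply: eq_sampleE => // S _; rewrite sampleE_setU1.
rewrite !UE.
have -> : sampleE E p (fun S => sampleE E q (fun S' => f (e |: S :|: (e |: S')))) =
          sampleE E p (fun S => sampleE E q (fun S' => f (e |: (S :|: S')))).
  by apply: eq_sampleE => // S _; apply: eq_sampleE => // S' _; rewrite -setUUr.
have -> : sampleE E p (fun S => sampleE E q (fun S' => f (S :|: (e |: S')))) =
          sampleE E p (fun S => sampleE E q (fun S' => f (e |: (S :|: S')))).
  by apply: eq_sampleE => // S _; apply: eq_sampleE => // S' _; rewrite setUCA.
have -> : sampleE E p (fun S => sampleE E q (fun S' => f (e |: S :|: S'))) =
          sampleE E p (fun S => sampleE E q (fun S' => f (e |: (S :|: S')))).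
  by apply: eq_sampleE => // S _; apply: eq_sampleE => // S' _; rewrite -setUA.
by ring.
Qed.

(** Raising the rate of one edge moves probability to the outcomes containing it, where [f] is
    smaller; the edges are treated one after the other. *)
Lemma sampleE_antimono E p q f : (forall e, 0 <= p e <= 1) ->
  (forall e, 0 <= q e <= 1) -> (forall e, e \in E -> p e <= q e) ->
  (forall S S', S \subset S' -> f S' <= f S) ->
  sampleE E q f <= sampleE E p f.
Proof.
move=> p01 q01; elim/set_ind: E f => [|e E eE IH] f pq fdec.
  by rewrite !sampleE_set0.
have pqE e' : e' \in E -> p e' <= q e' by move=> e'E; apply/pq/setU1r.
have le1 := IH f pqE fdec.
have le2 : sampleE E q (fun S => f (e |: S)) <= sampleE E p (fun S => f (e |: S)).
  by apply: (IH _ pqE) => S S' SS'; apply/fdec/setUS.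
have le3 : sampleE E p (fun S => f (e |: S)) <= sampleE E p f.
  by apply: le_sampleE => // S _; apply/fdec/subsetUr.
rewrite !sampleE_setU1 //; have := pq e (setU11 e E).
case/andP: (p01 e) => p0 p1; case/andP: (q01 e) => q0 q1 pqe.
move: (sampleE E q f) (sampleE E p f) (sampleE E q _) (sampleE E p _) le1 le2 le3
  => a b c d.
by move: (p e) (q e) p0 p1 q0 q1 pqe => P Q; nra.
Qed.

Lemma sampleE_expn_card E p (c : R) :
  sampleE E p (fun S => c ^+ #|S|) = \prod_(e in E) (1 + p e * (c - 1)).
Proof.
elim/set_ind: E => [|e E eE IH]; first by rewrite sampleE_set0 cards0 big_set0.
rewrite sampleE_setU1 // big_setU1 //= -IH.
have -> : sampleE E p (fun S => c ^+ #|e |: S|) = c * sampleE E p (fun S => c ^+ #|S|).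
  rewrite -sampleEZ; apply: eq_sampleE => // S SE.
  by rewrite cardsU1 (contra (subsetP SE e) eE) exprS.
by ring.
Qed.

End Expectation.

(** * Connectivity by a set of edges *)

Definition link (V : finType) (S : {set {set V}}) : rel V :=
  connect [rel u v | [set u; v] \in S].

Definition comp_of (V : finType) (S : {set {set V}}) (u : V) : {set V} :=
  [set v | link S u v].

Section Link.
Variable V : finType.
Implicit Types (S : {set {set V}}) (u v w : V).

Lemma link_refl S u : link S u u.
Proof. exact: connect0. Qed.

Lemma link_sym S u v : link S u v = link S v u.
Proof. by apply: sym_connect_sym => x y /=; rewrite setUC. Qed.

Lemma link_trans S : transitive (link S).
Proof. exact: connect_trans. Qed.

Lemma link_edge S u v : [set u; v] \in S -> link S u v.
Proof. by move=> uvS; apply: connect1. Qed.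

Lemma link_mono S S' u v : S \subset S' -> link S u v -> link S' u v.
Proof.
move=> SS'; apply: connect_sub => x y /= xyS.
by apply: link_edge; apply: subsetP SS' _ xyS.
Qed.

Lemma comp_mono S S' u : S \subset S' -> comp_of S u \subset comp_of S' u.
Proof. by move=> SS'; apply/subsetP => v; rewrite !inE; apply: link_mono. Qed.

Lemma card_comp_gt0 S u : (0 < #|comp_of S u|)%N.
Proof. by apply/card_gt0P; exists u; rewrite inE link_refl. Qed.

Lemma card_comp_merge S u v : ~~ link S u v ->
  (#|comp_of S u| + #|comp_of S v| <= #|comp_of ([set u; v] |: S) u|)%N.
Proof.
move=> nuv; have dis : [disjoint comp_of S u & comp_of S v].
  apply/pred0P => w /=; apply/negP; rewrite !inE => /andP[uw vw].
  by case/negP: nuv; apply: link_trans uw _; rewrite link_sym.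
have := dis; rewrite -leq_card_setU => /eqP <-; apply: subset_leq_card.
have sub : S \subset [set u; v] |: S by apply: subsetUr.
rewrite subUset comp_mono //=; apply/subsetP => w; rewrite !inE => vw.
by apply: link_trans (link_mono sub vw); apply: link_edge; apply: setU11.
Qed.

End Link.

(** * Degrees and rounded degrees *)

Section Degrees.
Variables (V : finType) (adj : rel V).

Lemma rdegree_gt0 u : (0 < rdegree adj u)%N.
Proof. by rewrite expn_gt0. Qed.

Lemma degree_gt0 u v : adj u v -> (0 < degree adj u)%N.
Proof. by move=> uv; apply/card_gt0P; exists v; rewrite inE. Qed.

Lemma rdegree_le u : (0 < degree adj u)%N -> (rdegree adj u <= degree adj u)%N.
Proof. by move=> d_gt0; apply: trunc_logP. Qed.

Lemma degree_lt u : (degree adj u < 2 * rdegree adj u)%N.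
Proof. by rewrite /rdegree -expnS; apply: trunc_log_ltn. Qed.

Lemma mem_edges u v : adj u v -> [set u; v] \in edges adj.
Proof. by move=> uv; apply/imsetP; exists (u, v); rewrite ?inE. Qed.

Lemma edgesP e :
  reflect (exists u v, adj u v /\ e = [set u; v]) (e \in edges adj).
Proof.
apply: (iffP imsetP) => [[[u v] uv ->]|[u [v [uv ->]]]].
  by rewrite inE in uv; exists u, v.
by exists (u, v); rewrite ?inE.
Qed.

Lemma redge_gt0 e : (0 < #|V|)%N -> (0 < redge adj e)%N.
Proof.
move=> n_gt0; rewrite /redge; elim/big_ind: _ => // [x y x0 y0|u _].
  by rewrite leq_min x0.
exact: rdegree_gt0.
Qed.

Lemma degree_lt_card u : irreflexive adj -> (degree adj u < #|V|)%N.
Proof.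
move=> irr; rewrite -cardsT; apply: proper_card.
apply/properP; split; first exact: subsetT.
by exists u; rewrite ?inE ?irr.
Qed.

End Degrees.

(** * Growth of components during the weak samples *)

Section Round.
Variables (R : realType) (V : finType) (adj : rel V) (K : R).
Hypotheses (adjC : symmetric adj) (adjI : irreflexive adj) (K2 : 2 <= K).
Implicit Types (S F : {set {set V}}) (x y w : V) (r N : nat).

(** The size bound [min (2^r) (degree x / K)], written as a disjunction to avoid the minimum and the
    division. *)
Definition grown r S x : bool :=
  (2 ^ r <= #|comp_of S x|)%N || ((degree adj x)%:R <= K * #|comp_of S x|%:R).

Definition round_rate (e : {set V}) : R := Num.min (K / (redge adj e)%:R) 1.

Lemma round_rate01 e : 0 <= round_rate e <= 1.
Proof.
rewrite /round_rate ge_min lexx orbT andbT le_min ler01 andbT.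
by rewrite divr_ge0 // (le_trans _ K2).
Qed.

Lemma grown_mono r S S' x : S \subset S' -> grown r S x -> grown r S' x.
Proof.
move=> SS'; have le := subset_leq_card (comp_mono x SS').
case/orP => [lo|hi]; apply/orP; [left; exact: leq_trans lo le|right].
by apply: le_trans hi _; rewrite ler_wpM2l ?ler_nat // (le_trans _ K2).
Qed.

(** A potential for one vertex: as long as [x] is not done it lies between 1 and 2, so it dominates
    the indicator of failure, and it falls linearly as the component of [x] grows. *)
Definition deficit r S x : R :=
  if grown r S x then 0 else 2 - #|comp_of S x|%:R * K / (degree adj x)%:R.

Lemma not_grown_lt r S x : ~~ grown r S x ->
  K * #|comp_of S x|%:R < (degree adj x)%:R.
Proof. by rewrite negb_or -ltNge => /andP[]. Qed.

Lemma not_grown_degree r S x : ~~ grown r S x -> 0 < (degree adj x)%:R :> R.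
Proof.
move/not_grown_lt; apply: le_lt_trans.
by rewrite mulr_ge0 // (le_trans _ K2).
Qed.

Lemma not_grown_div r S x : ~~ grown r S x ->
  #|comp_of S x|%:R * K / (degree adj x)%:R < 1.
Proof.
move=> ng; have d0 := not_grown_degree ng.
by rewrite ltr_pdivrMr // mul1r mulrC; apply: not_grown_lt ng.
Qed.

Lemma not_grown_K_div r S x : ~~ grown r S x -> K / (degree adj x)%:R < 1.
Proof.
move=> ng; have d0 := not_grown_degree ng.
rewrite ltr_pdivrMr // mul1r; apply: le_lt_trans (not_grown_lt ng).
by rewrite ler_peMr ?(le_trans _ K2) // ler1n card_comp_gt0.
Qed.

Lemma deficit_ge r S x : (~~ grown r S x)%:R <= deficit r S x.
Proof.
rewrite /deficit; case: ifPn => // /not_grown_div.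
by move: (_ * K / _) => z; rewrite [_%:R]/=; lra.
Qed.

Lemma deficit_le2 r S x : deficit r S x <= 2.
Proof.
rewrite /deficit; case: ifPn => // _; rewrite gerBl.
by rewrite divr_ge0 // mulr_ge0 // (le_trans _ K2).
Qed.

(** A success either finishes [x], which lowers the deficit by at least 1, or adds the component of
    [w], whose size is at least [1 / q]. In both cases the expected drop is at least [K / degree x];
    as the deficit is at most 2, this is a contraction by the stated factor. *)
Lemma round_step r S x w : (forall y, grown r S y) ->
  ~~ grown r.+1 S x -> adj x w -> ~~ link S x w ->
  let q := round_rate [set x; w] in
  q * deficit r.+1 ([set x; w] |: S) x + (1 - q) * deficit r.+1 S x <=
  (1 - K / (degree adj x)%:R / 2) * deficit r.+1 S x.
Proof.
move=> gr ng xw nl /=.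
set q := round_rate _; set S' := _ |: S; set z := K / _.
have z1 : z < 1 by apply: not_grown_K_div ng.
have d0 := not_grown_degree ng.
have z0 : 0 <= z by rewrite divr_ge0 ?(le_trans _ K2) // ltW.
have dx : (0 < degree adj x)%N by rewrite -(ltr0n R).
have dw : (0 < degree adj w)%N by apply: (@degree_gt0 _ _ w x); rewrite adjC.
have e0 : 0 < (redge adj [set x; w])%:R :> R.
  by rewrite ltr0n redge_pair // leq_min !rdegree_gt0.
have K0 : 0 <= K by rewrite (le_trans _ K2).
have qz : z <= q.
  rewrite /q le_min (ltW z1) andbT; apply: ler_wpM2l => //.
  rewrite lef_pV2 ?posrE // ler_nat redge_pair //.
  by rewrite (leq_trans (geq_minl _ _)) ?rdegree_le.
have D2 := deficit_le2 r.+1 S x.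
suff: z <= q * (deficit r.+1 S x - deficit r.+1 S' x).
  move=> h; suff : z / 2 * deficit r.+1 S x <= z by lra.
  by nra.
have [gr'|ng'] := boolP (grown r.+1 S' x).
  have := deficit_ge r.+1 S x; rewrite [X in _ - X]/deficit gr' ng subr0 /=.
  by nra.
have merge : (#|comp_of S x| + #|comp_of S w| <= #|comp_of S' x|)%N.
  exact: card_comp_merge.
(* If the components of [x] and [w] both had [2^r] vertices, their union would have [2^(r+1)] and
   [x] would be done. Hence [degree w <= K |C|] for the component [C] of [w], and [rd e <= degree w]
   gives [q >= 1 / |C|]. *)
have big : q * #|comp_of S w|%:R >= 1.
  have : (degree adj w)%:R <= K * #|comp_of S w|%:R.
    have /orP[bw|//] := gr w.
    have /orP[bx|bx] := gr x; last first.
      by have := not_grown_lt ng; rewrite ltNge bx.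
    case/negP: ng'; apply/orP; left.
    by apply: leq_trans merge; rewrite expnS mul2n -addnn leq_add.
  move=> dwK; have s0 : 0 < #|comp_of S w|%:R :> R by rewrite ltr0n card_comp_gt0.
  rewrite -ler_pdivrMr // div1r le_min; apply/andP; split; last first.
    by rewrite invf_le1 // ler1n card_comp_gt0.
  rewrite ler_pdivlMr // mulrC ler_pdivrMr //; apply: le_trans dwK.
  rewrite ler_nat redge_pair //.
  by rewrite (leq_trans (geq_minr _ _)) ?rdegree_le.
rewrite /deficit (negPf ng) (negPf ng').
have : #|comp_of S x|%:R + #|comp_of S w|%:R <= #|comp_of S' x|%:R :> R.
  by rewrite -natrD ler_nat.
rewrite -![_ * K / _]mulrA -/z.
move: (#|comp_of S x|%:R) (#|comp_of S w|%:R) (#|comp_of S' x|%:R) big => a b c big abc.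
have q0 : 0 <= q by apply: le_trans qz.
have : q * (z * b) <= q * (z * (c - a)).
  by rewrite ler_wpM2l // ler_wpM2l //; lra.
have : z <= z * (q * b) by rewrite ler_peMr.
by nra.
Qed.

(** Distinct neighbours of [x] give distinct edges, so [F] blocks at most [#|F|] neighbours and the
    component of [x] at most its size. *)
Lemma exists_fresh_neighbour S F x :
  (#|comp_of S x| + #|F| < degree adj x)%N ->
  exists w, [/\ adj x w, ~~ link S x w & [set x; w] \notin F].
Proof.
move=> lt; pose A := [set w | adj x w]; pose B := [set w | [set x; w] \in F].
have inj : {in A &, injective (fun w => [set x; w])}.
  move=> v w; rewrite !inE => xv xw vw.
  have : v \in [set x; w] by rewrite -vw set22.
  by rewrite !inE => /orP[/eqP vx|/eqP //]; rewrite vx adjI in xv.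
have cardAB : (#|A :&: B| <= #|F|)%N.
  rewrite -(card_in_imset (f := fun w => [set x; w]) (D := A :&: B)).
    apply/subset_leq_card/subsetP => _ /imsetP[w /setIP[_ wB] ->].
    by rewrite inE in wB.
  by move=> v w /setIP[vA _] /setIP[wA _]; apply: inj.
have : ~~ (A \subset comp_of S x :|: (A :&: B)).
  apply: contraL lt => /subset_leq_card sub; rewrite -leqNgt.
  apply: leq_trans sub _; apply: leq_trans (leq_card_setU _ _) _.
  by rewrite leq_add2l.
case/subsetPn => w wA; rewrite !inE negb_or; rewrite !inE in wA.
by rewrite wA /= => /andP[wS wF]; exists w.
Qed.

(* [F] holds the edges that were already flipped.  Since at most half
   (rounded up) of the edges at [x] are ever flipped, a neighbour outside the component of [x] with
   an unflipped edge to [x] exists as long as [x] is not done. *)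
Lemma round_flips r x N S F : (forall y, grown r S y) ->
  (#|F| + N <= uphalf (degree adj x))%N ->
  sampleE (edges adj :\: F) round_rate (fun S' => (~~ grown r.+1 (S :|: S') x)%:R)
  <= (1 - K / (degree adj x)%:R / 2) ^+ N * deficit r.+1 S x.
Proof.
elim: N S F => [|N IH] S F gr leN.
  rewrite expr0 mul1r -[leRHS](sampleE_cst (edges adj :\: F) round_rate).
  apply: le_sampleE => [e|S' _]; first exact: round_rate01.
  apply: le_trans (deficit_ge _ _ _); rewrite ler_nat.
  case: (boolP (grown r.+1 S x)) => [g|_]; last exact: leq_b1.
  by rewrite (grown_mono (subsetUl S S') g).
have [g|ng] := boolP (grown r.+1 S x).
  rewrite /deficit g mulr0 -[leRHS](sampleE_cst (edges adj :\: F) round_rate).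
  apply: le_sampleE => [e|S' _]; first exact: round_rate01.
  by rewrite (grown_mono (subsetUl S S') g).
have [w [xw nl eF]] : exists w, [/\ adj x w, ~~ link S x w & [set x; w] \notin F].
  apply: exists_fresh_neighbour.
  (* As [K >= 2], the component has fewer than [degree x / 2] vertices. The flip about to be made is
     counted in [N.+1], so [2 * #|F|] is below the degree as well. *)
  have : (2 * #|comp_of S x| < degree adj x)%N.
    rewrite -(ltr_nat R); apply: le_lt_trans (not_grown_lt ng).
    by rewrite natrM ler_wpM2r.
  by move: leN; rewrite uphalf_half; have := odd_double_half (degree adj x); lia.
set e := [set x; w] in eF *.
have -> : edges adj :\: F = e |: (edges adj :\: (e |: F)).
  apply/setP => e'; rewrite !inE; case: eqP => [->|//].
  by rewrite eF mem_edges.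
rewrite sampleE_setU1; last by rewrite !inE eqxx.
have leN' : (#|e |: F| + N <= uphalf (degree adj x))%N.
  by rewrite cardsU1 eF add1n addSn -addnS.
have gr' y : grown r (e |: S) y by apply: grown_mono (gr y); apply: subsetUr.
have := IH S _ gr leN'; have := IH _ _ gr' leN'.
have -> : sampleE (edges adj :\: (e |: F)) round_rate
     (fun S' => (~~ grown r.+1 (e |: S :|: S') x)%:R) =
   sampleE (edges adj :\: (e |: F)) round_rate
     (fun S' => (~~ grown r.+1 (S :|: (e |: S')) x)%:R).
  by apply: eq_sampleE => // S' _; rewrite setUCA setUA.
have := round_step gr ng xw nl; have /andP[] := round_rate01 e.
rewrite /= -/e; set q := round_rate e => q0 q1.
set c := 1 - _ / 2; have c0 : 0 <= c ^+ N.
  by apply: exprn_ge0; have := not_grown_K_div ng; rewrite /c; lra.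
rewrite exprSr; move: (sampleE _ _ _) (sampleE _ _ _) => a b step la lb.
apply: le_trans (_ : q * (c ^+ N * deficit r.+1 (e |: S) x) +
   (1 - q) * (c ^+ N * deficit r.+1 S x) <= _).
  by apply: lerD; apply: ler_wpM2l => //; lra.
rewrite -mulrA; apply: le_trans (ler_wpM2l c0 step).
by rewrite le_eqVlt; apply/orP; left; apply/eqP; ring.
Qed.

(** With [d = degree x], at least [d / 2] flips contract a deficit of at most 2 by [1 - K / (2 d)]
    each, and [(1 - K / (2 d))^(d / 2) <= exp (- K / 4)]. *)
Lemma round_vertex r x S : (forall y, grown r S y) ->
  sampleE (edges adj) round_rate (fun S' => (~~ grown r.+1 (S :|: S') x)%:R)
  <= 2 * expR (- (K / 4)).
Proof.
move=> gr; have := @round_flips r x (uphalf (degree adj x)) S set0 gr.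
rewrite cards0 add0n setD0 => /(_ (leqnn _))/le_trans; apply.
have [g|ng] := boolP (grown r.+1 S x).
  by rewrite /deficit g mulr0 mulr_ge0 ?expR_ge0.
have K0 : 0 <= K by rewrite (le_trans _ K2).
rewrite mulrC; apply: ler_pM.
- by apply: le_trans (deficit_ge _ _ _).
- by apply: exprn_ge0; have := not_grown_K_div ng; lra.
- exact: deficit_le2.
have d0 := not_grown_degree ng.
set d := degree adj x in d0 *.
apply: le_trans (_ : expR (- (K / d%:R / 2)) ^+ uphalf d <= _).
  apply: lerXn2r; rewrite ?nnegrE ?expR_ge0 //; last exact: expR_ge1Dx.
  by have := not_grown_K_div ng; rewrite -/d; lra.
rewrite -expRM_natl ler_expR mulrN lerN2.
have -> : K / 4 = K / d%:R / 2 * (d%:R / 2) by field; lra.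
rewrite [leRHS]mulrC.
apply: ler_wpM2l; first by rewrite !divr_ge0 // ltW.
rewrite ler_pdivrMr // -natrM ler_nat uphalf_half.
by have := odd_double_half d; lia.
Qed.

Lemma round_all r S : (forall y, grown r S y) ->
  sampleE (edges adj) round_rate
    (fun S' => (~~ [forall x, grown r.+1 (S :|: S') x])%:R)
  <= #|V|%:R * (2 * expR (- (K / 4))).
Proof.
move=> gr; apply: le_trans (_ : \sum_(x : V) sampleE (edges adj) round_rate
   (fun S' => (~~ grown r.+1 (S :|: S') x)%:R) <= _); last first.
  apply: le_trans (ler_sum _ (fun x _ => round_vertex x gr)) _.
  by rewrite sumr_const -(mulr_natl (2 * _)).
rewrite -sampleE_sum; apply: le_sampleE => [e|S' _]; first exact: round_rate01.
rewrite negb_forall; case: existsP => [[x ng]|_]; last by rewrite sumr_ge0.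
by rewrite (bigD1 x) //= ng lerDl sumr_ge0.
Qed.

(** Union bound over the rounds: either the invariant already failed, or it holds and the next round
    breaks it with small probability. It holds at the start because every component has [1 = 2^0]
    vertices. *)
Lemma rounds r :
  sampleE (edges adj) (fun e => 1 - (1 - round_rate e) ^+ r)
    (fun S => (~~ [forall x, grown r S x])%:R)
  <= r%:R * (#|V|%:R * (2 * expR (- (K / 4)))).
Proof.
elim: r => [|r IH].
  rewrite mul0r (eq_sampleE (q := fun=> 0) (g := fun=> 0)) ?sampleE_cst // => [e|S _].
    by rewrite expr0 subrr.
  suff -> : [forall x, grown 0 S x] by [].
  by apply/forallP => x; rewrite /grown card_comp_gt0.
have -> : sampleE (edges adj) (fun e => 1 - (1 - round_rate e) ^+ r.+1)
    (fun S => (~~ [forall x, grown r.+1 S x])%:R) =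
  sampleE (edges adj) (fun e => 1 - (1 - round_rate e) ^+ r) (fun S =>
    sampleE (edges adj) round_rate
      (fun S' => (~~ [forall x, grown r.+1 (S :|: S') x])%:R)).
  rewrite (sampleE_setU _ _ _ (fun S => (~~ [forall x, grown r.+1 S x])%:R)).
  by apply: eq_sampleE => // e; rewrite opprB addrCA subrr addr0 exprSr.
rewrite mulrSr mulrDl mul1r; set c := #|V|%:R * _.
apply: le_trans (lerD IH (lexx c)); rewrite -[X in _ + X](sampleE_cst (edges adj)
  (fun e => 1 - (1 - round_rate e) ^+ r)) -sampleED.
have c0 : 0 <= c by rewrite !mulr_ge0 ?expR_ge0.
apply: le_sampleE => [e|S _].
  have /andP[q0 q1] := round_rate01 e.
  have h0 : 0 <= (1 - round_rate e) ^+ r by apply: exprn_ge0; lra.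
  have h1 : (1 - round_rate e) ^+ r <= 1 by apply: exprn_ile1; lra.
  by lra.
case: (boolP [forall x, _]) => [/forallP gr|_].
  by rewrite add0r; apply: round_all.
apply: le_trans (_ : 1 <= _); last by rewrite lerDl.
rewrite -[leRHS](sampleE_cst (edges adj) round_rate).
by apply: le_sampleE => [e|S' _]; [exact: round_rate01 | rewrite lern1 leq_b1].
Qed.

End Round.

(** * Component weights, carried by leaders *)

Section Leaders.
Variables (V : finType) (adj : rel V).
Implicit Types (S : {set {set V}}) (u v w : V).

(** Orders vertices by rounded degree and breaks ties by rank, so that each component has exactly
    one vertex of maximal key. *)
Definition key u : nat := (rdegree adj u * #|V| + enum_rank u)%N.

Definition leader S u : bool := [forall v in comp_of S u, (key v <= key u)%N].

(** The sum over the components of their largest rounded degree, indexed by leaders instead of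
    components. *)
Definition weight S : nat := (\sum_(u | leader S u) rdegree adj u)%N.

Lemma key_inj : injective key.
Proof.
move=> u v /(congr1 (fun k => k %% #|V|)%N).
by rewrite /key !modnMDl !modn_small // => /ord_inj/enum_rank_inj.
Qed.

Lemma key_rdegree u v : (key u <= key v)%N -> (rdegree adj u <= rdegree adj v)%N.
Proof.
rewrite /key => le; rewrite leqNgt; apply/negP => lt.
have := leq_mul lt (leqnn #|V|); rewrite mulSn leqNgt => /negP; apply.
apply: leq_ltn_trans (leq_trans (leq_addr _ _) le) _.
by rewrite addnC ltn_add2r ltn_ord.
Qed.

Lemma exists_leader S u : exists w,
  [/\ link S u w, leader S w & (rdegree adj u <= rdegree adj w)%N].
Proof.
have uu : u \in comp_of S u by rewrite inE link_refl.
case: (@arg_maxnP _ u (mem (comp_of S u)) key uu) => w /=.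
rewrite inE => uw max; exists w; split => //.
  apply/forall_inP => v; rewrite inE => wv; apply: max.
  by rewrite inE (link_trans uw wv).
by apply/key_rdegree/max; rewrite inE link_refl.
Qed.

Lemma leader_uniq S u v : link S u v -> leader S u -> leader S v -> u = v.
Proof.
move=> uv /forall_inP lu /forall_inP lv; apply: key_inj; apply/eqP.
by rewrite eqn_leq lu ?lv // inE // link_sym.
Qed.

Lemma leader_antimono S S' u : S \subset S' -> leader S' u -> leader S u.
Proof.
move=> SS' /forall_inP lu; apply/forall_inP => v vS.
exact/lu/(subsetP (comp_mono u SS')).
Qed.

Lemma weight_antimono S S' : S \subset S' -> (weight S' <= weight S)%N.
Proof.
move=> SS'; rewrite /weight [in leqLHS]big_mkcond [in leqRHS]big_mkcond /=.
apply: leq_sum => u _; case: ifP => // /(leader_antimono SS') ->.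
exact: leqnn.
Qed.

(** After the merge at most one of the two old leaders remains a leader. The one that is lost has at
    least the rounded degree of its end of the edge. *)
Lemma weight_merge S u v : ~~ link S u v ->
  (weight ([set u; v] |: S) + minn (rdegree adj u) (rdegree adj v)
   <= weight S)%N.
Proof.
move=> nuv; set S' := _ |: S; have SS' : S \subset S' by apply: subsetUr.
have [u' [uu' lu' ru']] := exists_leader S u.
have [v' [vv' lv' rv']] := exists_leader S v.
have uv' : link S' u' v'.
  apply: link_trans (link_mono SS' vv').
  apply: (@link_trans _ _ u); first by rewrite link_sym; apply: link_mono uu'.
  by apply/link_edge/setU11.
have [w [lw nlw rw]] : exists w, [/\ leader S w, ~~ leader S' w &
    (minn (rdegree adj u) (rdegree adj v) <= rdegree adj w)%N].
  have [luS|nlu] := boolP (leader S' u'); last first.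
    by exists u'; split=> //; apply: leq_trans (geq_minl _ _) ru'.
  exists v'; split=> //; last by apply: leq_trans (geq_minr _ _) rv'.
  apply/negP => /(leader_uniq uv' luS) eq; case/negP: nuv.
  by apply: link_trans uu' _; rewrite eq link_sym.
rewrite [in leqRHS]/weight (bigD1 w) //= addnC leq_add //.
rewrite /weight [in leqLHS]big_mkcond [in leqRHS]big_mkcond /=.
apply: leq_sum => x _; case: ifP => // lx.
rewrite (leader_antimono SS' lx) /=; case: eqP => [xw|//].
by rewrite xw (negPf nlw) in lx.
Qed.

(** Double counting: each vertex lies in the component of at most one leader. *)
Lemma sum_card_comp_leader S : (\sum_(u | leader S u) #|comp_of S u| <= #|V|)%N.
Proof.
under eq_bigr do rewrite -sum1_card.
rewrite (exchange_big_dep xpredT) //= -sum1_card; apply: leq_sum => v _.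
rewrite sum1_card; apply/card_le1P => u; rewrite unfold_in inE => /andP[lu uv] w.
rewrite unfold_in !inE; apply/idP/eqP => [/andP[lw wv]|->]; last by rewrite lu.
by apply: leader_uniq lw lu; apply: link_trans wv _; rewrite link_sym.
Qed.

Lemma weight_le (R : realType) (K : R) S : 1 <= K ->
  (forall u, (degree adj u)%:R <= K * #|comp_of S u|%:R) ->
  (weight S)%:R <= K * #|V|%:R.
Proof.
move=> K1 degK; have K0 : 0 <= K by apply: le_trans K1.
apply: le_trans (_ : K * (\sum_(u | leader S u) #|comp_of S u|)%:R <= _).
  rewrite /weight !natr_sum mulr_sumr; apply: ler_sum => u _.
  (* An isolated vertex has rounded degree 1, not 0; it is paid for by [1 <= K] and its component of
     size at least 1. *)
  have [d0|dpos] := posnP (degree adj u).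
    rewrite /rdegree d0 /= -[1%:R]mulr1; apply: ler_pM => //.
    by rewrite ler1n card_comp_gt0.
  by apply: le_trans (degK u); rewrite ler_nat rdegree_le.
by rewrite ler_wpM2l // ler_nat sum_card_comp_leader.
Qed.

End Leaders.

(** * Crossing edges and the component graph *)

Definition crossing (V : finType) (S : {set {set V}}) (e : {set V}) : bool :=
  [exists u in e, exists v in e, ~~ link S u v].

Definition crossings (V : finType) (E S : {set {set V}}) : {set {set V}} :=
  [set e in E | crossing S e].

Section Crossing.
Variables (V : finType).
Implicit Types (S E : {set {set V}}) (u v : V).

Lemma crossing_pair S u v : crossing S [set u; v] = ~~ link S u v.
Proof.
apply/idP/idP => [/exists_inP[x xe /exists_inP[y ye]]|nuv].
  move: xe ye; rewrite !inE => /orP[]/eqP-> /orP[]/eqP->;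
    by rewrite ?link_refl // link_sym.
by apply/exists_inP; exists u; rewrite ?set21 //; apply/exists_inP; exists v;
  rewrite ?set22.
Qed.

Lemma crossing_antimono S S' e : S \subset S' -> crossing S' e -> crossing S e.
Proof.
move=> SS' /exists_inP[x xe /exists_inP[y ye nxy]].
apply/exists_inP; exists x => //; apply/exists_inP; exists y => //.
by apply: contra nxy; apply: link_mono.
Qed.

Lemma card_crossings_antimono E S S' : S \subset S' ->
  (#|crossings E S'| <= #|crossings E S|)%N.
Proof.
move=> SS'; apply/subset_leq_card/subsetP => e; rewrite !inE => /andP[-> /=].
exact: crossing_antimono.
Qed.

(** Each edge of the component graph is the image of a crossing edge when endpoints are sent to
    their components; several crossing edges may share an image. *)
Lemma card_edges_cg adj S :
  (#|edges (cg adj S)| <= #|crossings (edges adj) S|)%N.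
Proof.
have compE C u : C \in components S -> u \in C -> C = comp_of S u.
  case/imsetP => x _ ->; rewrite !inE /= => xu; apply/setP => y; rewrite !inE /=.
  have ux : link S u x by rewrite link_sym.
  by apply/idP/idP => h; apply: link_trans h.
apply: leq_trans (leq_imset_card (fun e : {set V} => comp_of S @: e) _).
apply/subset_leq_card/subsetP => _ /edgesP[C [D [CD ->]]].
case/and4P: CD => CS DS neq /exists_inP[u uC /exists_inP[v vD uv]].
apply/imsetP; exists [set u; v]; last first.
  by rewrite imsetU !imset_set1 -(compE C u) // -(compE D v).
rewrite inE mem_edges //= crossing_pair; apply: contra neq => luv.
by rewrite (compE D u) -?(compE C u) // (compE D v) // inE link_sym.
Qed.

End Crossing.

(** * Exponential moment of the number of crossing edges after the last sample *)

Lemma exprD1_ge (R : realDomainType) (x : R) n : 0 <= x ->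
  1 + x * n%:R <= (1 + x) ^+ n.
Proof.
move=> x0; elim: n => [|n IH]; first by rewrite mulr0 addr0.
have : 0 <= x * n%:R by rewrite mulr_ge0.
by rewrite exprS mulrSr => xn; nra.
Qed.

Section Contraction.
Variables (R : realType) (V : finType) (adj : rel V) (a eta theta : R).
Hypotheses (adjC : symmetric adj) (adjI : irreflexive adj).
Hypotheses (a0 : 0 <= a) (eta0 : 0 <= eta) (theta0 : 0 <= theta).
Hypotheses (eta_n : eta * #|V|%:R <= 1) (theta_le : 2 * theta <= a * eta).

Definition final_rate (e : {set V}) : R := Num.min (a / (redge adj e)%:R) 1.

Lemma final_rate01 e : 0 <= final_rate e <= 1.
Proof.
by rewrite /final_rate ge_min lexx orbT andbT le_min ler01 andbT divr_ge0.
Qed.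

Lemma redge_lt_card e : e \in edges adj -> (redge adj e < #|V|)%N.
Proof.
case/edgesP => u [v [uv ->]]; rewrite redge_pair //.
apply: leq_ltn_trans (geq_minl _ _) _.
by apply: leq_ltn_trans (rdegree_le (degree_gt0 uv)) _; apply: degree_lt_card.
Qed.

(** The balance for one crossing edge: a success saves the factor [(1 + eta) ^+ redge adj e] through
    the drop in weight, a failure costs the factor [1 + theta]. *)
Lemma final_rate_step e : e \in edges adj ->
  final_rate e + (1 - final_rate e) * (1 + theta) * (1 + eta) ^+ redge adj e
  <= (1 + eta) ^+ redge adj e.
Proof.
move=> eE; have r0 : 0 < (redge adj e)%:R :> R.
  by case/edgesP: eE => u [v [uv ->]]; rewrite ltr0n redge_pair // leq_min !rdegree_gt0.
have rn : eta * (redge adj e)%:R <= 1.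
  by apply: le_trans eta_n; rewrite ler_wpM2l // ler_nat ltnW // redge_lt_card.
have bern : 1 + eta * (redge adj e)%:R <= (1 + eta) ^+ redge adj e.
  exact: exprD1_ge.
set q := final_rate e; set B := (1 + eta) ^+ _ in bern *.
have /andP[q0 q1] : 0 <= q <= 1 by apply: final_rate01.
have [q_1|q_a] : q = 1 \/ q * (redge adj e)%:R = a.
  rewrite /q /final_rate; case: (leP (a / _) 1) => _; [right|by left].
  by rewrite divfK // gt_eqF.
- rewrite q_1; have : 0 <= eta * (redge adj e)%:R by rewrite mulr_ge0 // ltW.
  by lra.
set r := (redge adj e)%:R in r0 rn bern q_a.
have : 2 * theta <= q * (eta * r) by rewrite mulrCA q_a [leRHS]mulrC.
move: (eta * r) (mulr_ge0 eta0 (ltW r0)) rn bern => z z0 z1 zB qz.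
(* With [B >= 1 + z] and [z <= 1], the claim [q (B - 1) >= (1 - q) theta B]
   follows from [B - 1 >= z B / 2]. *)
have B1 : z * B <= 2 * (B - 1) by nra.
have : q * (z * B) <= q * (2 * (B - 1)) by rewrite ler_wpM2l.
have : 2 * theta * B <= q * z * B by rewrite ler_wpM2r //; lra.
have : (1 - q) * theta * B <= theta * B.
  by rewrite ler_wpM2r ?ler_piMl //; lra.
by nra.
Qed.

(** The potential [(1 + eta) ^+ weight adj S] pays for all edges still to be revealed. An edge that
    does not cross never will and can only lower the weight; a crossing edge is paid for by
    [final_rate_step]. The set [S] is general since it absorbs the sampled edges. *)
Lemma sampleE_crossings (F S : {set {set V}}) : F \subset edges adj ->
  sampleE F final_rate (fun S' => (1 + theta) ^+ #|crossings F (S :|: S')|)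
  <= (1 + eta) ^+ weight adj S.
Proof.
have t1 : 1 <= 1 + theta by rewrite lerDl.
have e1 : 1 <= 1 + eta by rewrite lerDl.
have rate01 := final_rate01.
elim/set_ind: F S => [|e F eF IH] S sub.
  rewrite sampleE_set0 (_ : crossings _ _ = set0) ?cards0 ?expr0 ?exprn_ege1 //.
  by apply/setP => e; rewrite !inE.
have [eE FE] : e \in edges adj /\ F \subset edges adj.
  by split; [apply: (subsetP sub); apply: setU11 |
    apply: subset_trans sub; apply: subsetUr].
rewrite sampleE_setU1 //; set q := final_rate e.
have /andP[q0 q1] : 0 <= q <= 1 by apply: rate01.
have [u [v [uv eq_e]]] := edgesP _ _ eE.
have le1 : sampleE F final_rate
    (fun S' => (1 + theta) ^+ #|crossings (e |: F) (S :|: (e |: S'))|)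
    <= (1 + eta) ^+ weight adj (e |: S).
  apply: le_trans (IH _ FE); apply: le_sampleE => // S' _.
  rewrite setUCA setUA ler_weXn2l //; apply/subset_leq_card/subsetP => f.
  rewrite !inE; case: eqP => [->|//]; rewrite eq_e crossing_pair.
  by rewrite link_edge // !inE eqxx.
have cross_le S' : (#|crossings (e |: F) (S :|: S')| <=
    crossing S e + #|crossings F (S :|: S')|)%N.
  apply: leq_trans (_ : #|(if crossing S e then [set e] else set0) :|:
     crossings F (S :|: S')| <= _)%N.
    apply/subset_leq_card/subsetP => f; rewrite !inE; case: eqP => [->|fe] /=.
      move=> cr; rewrite (crossing_antimono _ cr) ?subsetUl //.
      by rewrite inE eqxx.
    by move=> ->; rewrite orbT.
  apply: leq_trans (leq_card_setU _ _) _; rewrite leq_add2r.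
  by case: ifP; rewrite ?cards1 ?cards0.
have le2 : sampleE F final_rate
    (fun S' => (1 + theta) ^+ #|crossings (e |: F) (S :|: S')|)
    <= (1 + theta) ^+ crossing S e * (1 + eta) ^+ weight adj S.
  have c0 : 0 <= (1 + theta) ^+ crossing S e by apply: exprn_ge0; apply: addr_ge0.
  apply: le_trans (ler_wpM2l c0 (IH S FE)).
  rewrite -sampleEZ; apply: le_sampleE => // S' _.
  by rewrite -exprD ler_weXn2l.
have q1' : 0 <= 1 - q by rewrite subr_ge0.
apply: le_trans (lerD (ler_wpM2l q0 le1) (ler_wpM2l q1' le2)) _.
have pos k : 0 <= (1 + eta) ^+ k by apply: exprn_ge0; apply: addr_ge0.
have [cr|ncr] := boolP (crossing S e); last first.
  rewrite expr0 mul1r; set W := (1 + eta) ^+ weight adj S.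
  apply: le_trans (_ : q * W + (1 - q) * W <= _).
    by rewrite lerD2r ler_wpM2l // ler_weXn2l // weight_antimono // subsetUr.
  by rewrite -mulrDl subrKC mul1r.
have drop : (weight adj (e |: S) + redge adj e <= weight adj S)%N.
  rewrite {2}eq_e redge_pair // eq_e weight_merge //.
  by rewrite -crossing_pair -eq_e.
rewrite expr1 -(subnKC drop) !exprD.
set x := (1 + eta) ^+ weight _ _; set y := (1 + eta) ^+ redge _ _.
set z := (1 + eta) ^+ (_ - _)%N.
have -> : q * x + (1 - q) * ((1 + theta) * (x * y * z)) =
  x * (q + (1 - q) * (1 + theta) * y * z) by ring.
rewrite -[leRHS]mulrA; apply: ler_wpM2l; first exact: pos.
apply: le_trans (_ : (q + (1 - q) * (1 + theta) * y) * z <= _); last first.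
  by apply: ler_wpM2r; [exact: pos | exact: final_rate_step].
by rewrite [leRHS]mulrDl lerD2r ler_peMr // exprn_ege1.
Qed.

End Contraction.

(** * Tail bounds and estimates of the logarithm *)

Lemma sampleE_markov (R : realType) (X : finType) (E : {set X}) (p : X -> R)
    (A : pred {set X}) (f : {set X} -> R) (b : R) :
  (forall e, 0 <= p e <= 1) -> 0 < b -> (forall S, 0 <= f S) ->
  (forall S, A S -> b <= f S) ->
  sampleE E p (fun S => (A S)%:R) <= sampleE E p f / b.
Proof.
move=> p01 b0 f0 fA; rewrite mulrC -sampleEZ; apply: le_sampleE => // S _.
case: (boolP (A S)) => [AS|_]; last by rewrite mulr_ge0 // invr_ge0 ltW.
by rewrite mulrC ler_pdivlMr // mul1r fA.
Qed.

Lemma expR_half_le (R : realType) (t x : R) n : 0 <= t <= 1 -> x <= n%:R ->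
  expR (t / 2 * x) <= (1 + t) ^+ n.
Proof.
move=> /andP[t0 t1] xn; have t20 : 0 <= t / 2 by rewrite divr_ge0.
apply: le_trans (_ : expR (t / 2) ^+ n <= _).
  by rewrite -expRM_natr ler_expR ler_wpM2l.
apply: lerXn2r; rewrite ?nnegrE ?expR_ge0 ?addr_ge0 //.
(* [1 / (1 + t) <= 1 - t / 2 <= exp (- t / 2)] on [0 <= t <= 1] *)
have := expR_ge1Dx (- (t / 2)); rewrite expRN.
rewrite -lef_pV2 ?posrE ?invr_gt0 ?expR_gt0 //; last by lra.
rewrite invrK => /le_trans; apply.
rewrite -[leLHS]mul1r ler_pdivrMr; last by lra.
by nra.
Qed.

Section Log.
Variables (R : realType) (n : nat).
Hypothesis n2 : (1 < n)%N.
Let L : R := log2 n%:R.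

Lemma ln2_gt0 : 0 < ln 2 :> R.
Proof. by rewrite ln_gt0 // ltr1n. Qed.

Lemma ln2_le1 : ln 2 <= 1 :> R.
Proof. by rewrite -[leRHS]expRK ler_ln ?posrE ?expR_gt0 // expR_ge1Dx. Qed.

Lemma natr_gt0 : 0 < n%:R :> R.
Proof. by rewrite ltr0n ltnW. Qed.

Lemma log2_ge1 : 1 <= L.
Proof.
rewrite /L /log2 ler_pdivlMr ?ln2_gt0 // mul1r ler_ln ?posrE ?natr_gt0 //.
by rewrite ler_nat.
Qed.

(** Here [n = 2^L] and [2 <= e]; this converts bounds [exp (- 3 L)] into [n^-3]. *)
Lemma natr_le_expR_log2 : n%:R <= expR L.
Proof.
rewrite -[leLHS]lnK ?posrE ?natr_gt0 // ler_expR /L /log2.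
rewrite ler_pdivlMr ?ln2_gt0 // ler_piMr ?ln2_le1 //.
by rewrite ln_ge0 // ler1n ltnW.
Qed.

Lemma log2_le_natr : L <= n%:R.
Proof.
rewrite /L /log2 ler_pdivrMr ?ln2_gt0 // mulr_natl -lnXn //.
rewrite ler_ln ?posrE ?natr_gt0 ?exprn_gt0 //.
by rewrite -natrX ler_nat ltnW // ltn_expl.
Qed.

Lemma trunc_log_le_log2 : (trunc_log 2 n)%:R <= L.
Proof.
rewrite /L /log2 ler_pdivlMr ?ln2_gt0 // mulr_natl -lnXn //.
rewrite ler_ln ?posrE ?natr_gt0 ?exprn_gt0 // -natrX ler_nat.
by apply: trunc_logP => //; apply: ltnW.
Qed.

End Log.

(** * The two failure events at the actual rates *)

Section Sampling.
Variables (R : realType) (V : finType) (adj : rel V).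
Hypotheses (adjC : symmetric adj) (adjI : irreflexive adj).
Hypothesis n2 : (1 < #|V|)%N.

Let n : R := #|V|%:R.
Let L : R := log2 n.
Let E := edges adj.
Let p := sample_rate R adj.

Let n_gt0 : 0 < n. Proof. exact: natr_gt0. Qed.
Let L1 : 1 <= L. Proof. exact: log2_ge1. Qed.
Let L0 : 0 < L. Proof. by apply: lt_le_trans L1. Qed.

Lemma sample_rate01 e : 0 <= p e <= 1.
Proof.
rewrite /p /sample_rate ge_min lexx orbT andbT le_min ler01 andbT.
by rewrite divr_ge0 // mulr_ge0 // sqr_ge0.
Qed.

(** Charge each edge to an endpoint of smaller rounded degree; a vertex [u] is then charged at most
    [degree u / rd u < 2]. *)
Lemma sum_inv_redge : \sum_(e in E) (redge adj e)%:R^-1 <= 2 * n.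
Proof.
apply: le_trans (_ : \sum_(uv : V * V | adj uv.1 uv.2) (rdegree adj uv.1)%:R^-1 <= _).
  rewrite [leRHS](partition_big (fun uv => [set uv.1; uv.2]) (mem E)) /=; last first.
    by move=> uv; apply: mem_edges.
  apply: ler_sum => e /edgesP[u [v [uv ->]]].
  have vu : adj v u by rewrite adjC.
  rewrite redge_pair //; have [_|_] := leqP (rdegree adj u) (rdegree adj v).
    rewrite (bigD1 (u, v)) /= ?uv ?eqxx //.
    by rewrite lerDl sumr_ge0 // => *; rewrite invr_ge0.
  rewrite (bigD1 (v, u)) /= ?vu ?[[set v; u]]setUC ?eqxx //.
  by rewrite lerDl sumr_ge0 // => *; rewrite invr_ge0.
rewrite -(pair_big_dep xpredT (fun u v => adj u v) (fun u v => (rdegree adj u)%:R^-1)) /=.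
apply: le_trans (_ : \sum_(u : V) 2 <= _); last first.
  by rewrite sumr_const -(mulr_natr 2).
apply: ler_sum => u _; rewrite sumr_const.
have -> : #|[pred v | adj u v]| = degree adj u by rewrite /degree cardsE.
rewrite -[leLHS]mulr_natl ler_pdivrMr ?ltr0n ?rdegree_gt0 //.
by rewrite -natrM ler_nat ltnW // degree_lt.
Qed.

Lemma many_sampled :
  sampleE E p (fun S => (206 * (n * L ^+ 2) < #|S|%:R)%R%:R) <= expR (- (3 * L)).
Proof.
have p01 := sample_rate01.
(* Chernoff bound with base 2: the moment is at most [exp (100 n L^2)] and the threshold is worth
   [exp (103 n L^2)], which leaves [3 n L^2 >= 3 L]. *)
apply: le_trans (sampleE_markov (f := fun S => 2 ^+ #|S|)
  (b := expR (1 / 2 * (206 * (n * L ^+ 2)))) _ p01 _ _ _) _.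
- exact: expR_gt0.
- by move=> S; apply: exprn_ge0.
- move=> S /ltW lt; rewrite [2](_ : _ = 1 + 1) //.
  by apply: expR_half_le => //; rewrite ler01 lexx.
rewrite sampleE_expn_card ler_pdivrMr ?expR_gt0 // -expRD.
apply: le_trans (_ : expR (\sum_(e in E) p e) <= _).
  rewrite expR_sum; apply: ler_prod => e _; have /andP[e0 _] := p01 e.
  rewrite (_ : 2 - 1 = 1) ?mulr1; last by ring.
  by rewrite addr_ge0 //= expR_ge1Dx.
rewrite ler_expR.
have : \sum_(e in E) p e <= 50 * L ^+ 2 * (2 * n).
  apply: le_trans (_ : 50 * L ^+ 2 * \sum_(e in E) (redge adj e)%:R^-1 <= _).
    by rewrite mulr_sumr; apply: ler_sum => e _; rewrite ge_min lexx.
  by rewrite ler_wpM2l ?sum_inv_redge // mulr_ge0 // sqr_ge0.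
have n1 : 1 <= n by rewrite ler1n ltnW.
have : L <= n * L ^+ 2 by rewrite expr2 mulrA ler_peMl ?(ltW L0) // mulr_ege1.
by lra.
Qed.

Let K : R := 25 * L.
Let q := round_rate adj K.
Let q' := final_rate adj (25 * L ^+ 2).
Let T := trunc_log 2 #|V|.

Let K2 : 2 <= K. Proof. by rewrite /K; move: L1; lra. Qed.

(** The constant 50 is split evenly: by Bernoulli's inequality the [T <= L] weak samples have joint
    rate at most [T K / rd e <= 25 L^2 / rd e], and the last sample adds at most as much. *)
Lemma rates_le e : e \in E ->
  0 <= 1 - (1 - (1 - (1 - q e) ^+ T)) * (1 - q' e) <= p e.
Proof.
move=> eE; have /andP[q0 q1] := round_rate01 adj K2 e.
have a0 : 0 <= 25 * L ^+ 2 by rewrite mulr_ge0 // sqr_ge0.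
have /andP[r0 r1] := final_rate01 adj a0 e.
rewrite -/q in q0 q1; rewrite -/q' in r0 r1.
have x0 : 0 <= (1 - q e) ^+ T by apply: exprn_ge0; lra.
have x1 : (1 - q e) ^+ T <= 1 by apply: exprn_ile1; lra.
have bern : 1 - T%:R * q e <= (1 - q e) ^+ T.
  elim: T => [|k IH]; first by rewrite mul0r expr0 subr0.
  rewrite exprS mulrSr; have : 0 <= k%:R * q e by rewrite mulr_ge0.
  by nra.
have Rge : 0 < (redge adj e)%:R :> R by rewrite ltr0n redge_gt0 // ltnW.
have Tq : T%:R * q e <= 25 * L ^+ 2 / (redge adj e)%:R.
  apply: le_trans (_ : L * (K / (redge adj e)%:R) <= _).
    by apply: ler_pM => //; [exact: trunc_log_le_log2 | rewrite ge_min lexx].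
  by rewrite /K le_eqVlt; apply/orP; left; apply/eqP; field; lra.
have rr : q' e <= 25 * L ^+ 2 / (redge adj e)%:R by rewrite ge_min lexx.
move: ((1 - q e) ^+ T) x0 x1 bern => x x0 x1 bern.
apply/andP; split; first by nra.
rewrite le_min; apply/andP; split; last by nra.
apply: le_trans (_ : (1 - x) + q' e <= _); first by nra.
rewrite -/n -/L
  (_ : 50 * _ / _ =
   25 * L ^+ 2 / (redge adj e)%:R + 25 * L ^+ 2 / (redge adj e)%:R).
  by lra.
by field; lra.
Qed.

Lemma crossings_after_rounds S : (forall x, grown adj K T S x) ->
  sampleE E q' (fun S' => (10 * n < #|crossings E (S :|: S')|%:R)%R%:R)
  <= expR (- (3 * L)).
Proof.
move=> gr.
have degK x : (degree adj x)%:R <= K * #|comp_of S x|%:R.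
  (* Since [n < 2^(T+1)], a component of [2^T] vertices holds more than half of all vertices, so
     [degree x < n < 2 |C| <= K |C|]. *)
  have /orP[big|//] := gr x.
  apply: le_trans (_ : 2 * #|comp_of S x|%:R <= _); last by rewrite ler_wpM2r.
  rewrite -natrM ler_nat; apply: leq_trans (ltnW (degree_lt_card x adjI)) _.
  have := @trunc_log_ltn 2 #|V| isT; rewrite -/T expnS => /ltnW/leq_trans; apply.
  by rewrite leq_mul2l.
(* [eta] makes [eta * (K * n) = 2], so the potential starts at no more than [exp 2], and [theta] is
   the largest value with [2 theta <= 25 L^2 eta]. Markov's threshold is [exp (5 L)], and
   [2 - 5 L <= - 3 L]. *)
pose eta : R := 2 / (25 * L * n); pose theta : R := L / n.
have a0 : 0 <= 25 * L ^+ 2 by rewrite mulr_ge0 // sqr_ge0.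
have eta0 : 0 <= eta.
  by rewrite divr_ge0 // (mulr_ge0 (mulr_ge0 _ (ltW L0)) (ltW n_gt0)).
have theta0 : 0 <= theta by rewrite divr_ge0 ?(ltW L0) ?(ltW n_gt0).
have theta1 : theta <= 1 by rewrite ler_pdivrMr // mul1r log2_le_natr.
have eta_n : eta * #|V|%:R <= 1.
  rewrite -/n (_ : eta * n = 2 / (25 * L)); last by rewrite /eta;
    field; rewrite ?(gt_eqF L0) ?(gt_eqF n_gt0).
  by rewrite ler_pdivrMr; move: L1; lra.
have theta_le : 2 * theta <= 25 * L ^+ 2 * eta.
  by rewrite le_eqVlt; apply/orP; left; apply/eqP; rewrite /eta /theta;
    field; rewrite ?(gt_eqF L0) ?(gt_eqF n_gt0).
apply: le_trans (sampleE_markov (f := fun S' => (1 + theta) ^+ #|crossings E (S :|: S')|)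
  (b := expR (theta / 2 * (10 * n))) _ (final_rate01 adj a0) _ _ _) _.
- exact: expR_gt0.
- by move=> S'; apply: exprn_ge0; rewrite addr_ge0.
- by move=> S' /ltW lt; apply: expR_half_le; rewrite ?theta0.
rewrite ler_pdivrMr ?expR_gt0 // -expRD.
apply: le_trans (sampleE_crossings adjC adjI a0 eta0 theta0 eta_n theta_le S (subxx E)) _.
apply: le_trans (_ : expR (eta * (weight adj S)%:R) <= _).
  rewrite expRM_natr; apply: lerXn2r; rewrite ?nnegrE ?expR_ge0 ?addr_ge0 //.
  exact: expR_ge1Dx.
rewrite ler_expR.
have K1 : 1 <= K by move: K2; lra.
apply: le_trans (ler_wpM2l eta0 (weight_le K1 degK)) _.
rewrite -/n (_ : eta * (K * n) = 2); last by rewrite /eta /K;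
    field; rewrite ?(gt_eqF L0) ?(gt_eqF n_gt0).
rewrite (_ : theta / 2 * (10 * n) = 5 * L); last by rewrite /theta;
    field; rewrite ?(gt_eqF L0) ?(gt_eqF n_gt0).
by move: L1; lra.
Qed.

Lemma many_crossings :
  sampleE E p (fun S => (10 * n < #|crossings E S|%:R)%R%:R) <= 2 * expR (- (3 * L)).
Proof.
have q01 := round_rate01 adj K2.
have a0 : 0 <= 25 * L ^+ 2 by rewrite mulr_ge0 // sqr_ge0.
have q'01 := final_rate01 adj a0.
pose qT e := 1 - (1 - q e) ^+ T.
have qT01 e : 0 <= qT e <= 1.
  have /andP[q0 q1] := q01 e; rewrite -/q in q0 q1.
  have x0 : 0 <= (1 - q e) ^+ T by apply: exprn_ge0; lra.
  have x1 : (1 - q e) ^+ T <= 1 by apply: exprn_ile1; lra.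
  by rewrite /qT; lra.
pose p' e := 1 - (1 - qT e) * (1 - q' e).
have p'01 e : 0 <= p' e <= 1.
  have := qT01 e; have := q'01 e; rewrite -/q' /p'.
  by move: (qT e) (q' e) => x y /andP[y0 y1] /andP[x0 x1]; nra.
(* Having many crossing edges is a decreasing event, so the sparser rate [p'] of the combined rounds
   may replace [p]. *)
apply: le_trans (sampleE_antimono (p := p') p'01 sample_rate01 _ _) _.
- by move=> e eE; have /andP[] := rates_le eE.
- move=> S S' SS'; rewrite ler_nat.
  case: (ltP _ #|crossings E S'|%:R) => // lt; rewrite lt0b.
  by apply: lt_le_trans lt _; rewrite ler_nat card_crossings_antimono.
rewrite -(sampleE_setU E qT q' (fun S => (10 * n < #|crossings E S|%:R)%R%:R)).
apply: le_trans (_ : sampleE E qT (fun S =>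
  (~~ [forall x, grown adj K T S x])%:R + expR (- (3 * L))) <= _).
  apply: le_sampleE => // S _; case: (boolP [forall x, _]) => [/forallP gr|_].
    by rewrite add0r; apply: crossings_after_rounds.
  apply: le_trans (_ : 1 <= _); last by rewrite lerDl expR_ge0.
  rewrite -[leRHS](sampleE_cst E q').
  by apply: le_sampleE => // S' _; rewrite lern1 leq_b1.
rewrite sampleED sampleE_cst [leRHS]mulr_natl mulr2n lerD2r.
apply: le_trans (rounds adjC adjI K2 T) _.
have nL : n <= expR L by apply: natr_le_expR_log2.
have nLL : n * (n * n) <= expR (3 * L).
  rewrite (_ : 3 * L = L + (L + L)); last by ring.
  by rewrite !expRD; apply: ler_pM => //; rewrite ?mulr_ge0 ?(ltW n_gt0) // ler_pM // ltW.
(* Both [T] and 2 are at most [n]; then [n^3 <= exp (3 L)] and [K / 4 = 25 L / 4 >= 6 L]. *)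
apply: le_trans (_ : n * (n * (n * expR (- (K / 4)))) <= _).
  apply: ler_pM => //; first by rewrite !mulr_ge0 ?expR_ge0.
    by apply: le_trans (log2_le_natr _ n2); apply: trunc_log_le_log2.
  rewrite ler_wpM2l ?(ltW n_gt0) // ler_wpM2r ?expR_ge0 //.
  by rewrite ler_nat.
rewrite 2!mulrA -(mulrA n n n).
apply: le_trans (ler_wpM2r (expR_ge0 _) nLL) _.
by rewrite -expRD ler_expR /K; move: L1; lra.
Qed.

End Sampling.

(** * Union bound over the two failure events *)

Theorem theorem13 (R : realType) :
  exists C1 C2 : R,
    forall (V : finType) (adj : rel V),
      symmetric adj -> irreflexive adj ->
      let n : R := #|V|%:R in
      1 - n^-1 <=
      sampleP (edges adj) (sample_rate R adj)
        [pred S : {set {set V}} |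
          (#|S|%:R <= C1 * (n * log2 n ^+ 2)) &&
          (#|edges (cg adj S)|%:R <= C2 * n)].
Proof.
exists 206, 10; move=> V adj adjC adjI /=; set n : R := #|V|%:R.
rewrite sampleP_sampleE /=.
have [n2|] := ltnP 1 #|V|; last first.
  (* For [n = 1] the required probability is 0. For [n = 0] it is 1, because [0^-1 = 0], and there
     are no edges. *)
  rewrite leq_eqVlt ltnS leqn0 => /orP[/eqP n1|/eqP n0].
    rewrite /n n1 invr1 subrr -(sampleE_cst (edges adj) (sample_rate R adj) 0).
    by apply: le_sampleE => // e; apply: sample_rate01.
  have noE : edges adj = set0.
    apply/setP => e; rewrite inE; apply/edgesP => -[u _].
    by have := fintype0 u; rewrite n0.
  have cg0 : #|edges (cg adj set0)| = 0%N.
    apply/eqP; rewrite -leqn0; apply: leq_trans (card_edges_cg _ _) _.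
    by rewrite noE leqn0 cards_eq0; apply/eqP/setP => e; rewrite !inE.
  by rewrite noE sampleE_set0 cg0 cards0 /n n0 invr0 subr0 !mulr0 mul0r mulr0 lexx.
set p := sample_rate R adj; set E := edges adj.
have p01 := sample_rate01 R adj.
have few1 := many_sampled R adjC n2; have few2 := many_crossings R adjC adjI n2.
rewrite -/n -/p -/E in few1 few2; set L := log2 n in few1 few2 *.
set A := sampleE E p _ in few1; set B := sampleE E p _ in few2.
(* The failures total at most [3 exp (- 3 L) <= 3 / n^3], which is at most [1 / n] because [n >= 2]
   gives [3 <= n^2]. *)
apply: le_trans (_ : 1 - A - B <= _).
  have n0 : 0 < n by apply: natr_gt0.
  have nL : n <= expR L by apply: natr_le_expR_log2.
  have nn : n ^+ 3 <= expR (3 * L).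
    by rewrite (expRM_natl 3); apply: lerXn2r; rewrite ?nnegrE ?expR_ge0 // ltW.
  have : 3 * expR (- (3 * L)) <= n^-1.
    apply: le_trans (_ : 3 * (n ^+ 3)^-1 <= _).
      by rewrite ler_wpM2l // expRN lef_pV2 ?posrE ?expR_gt0 ?exprn_gt0.
    rewrite ler_pdivrMr ?exprn_gt0 // exprS mulKf ?gt_eqF //.
    have : 2 <= n by rewrite ler_nat.
    by move=> ?; rewrite expr2; nra.
  by lra.
(* It remains to check pointwise that the indicators of success and of the two failures sum to at
   least 1. *)
rewrite !lerBlDr /A /B -!sampleED -[leLHS](sampleE_cst E p).
apply: le_sampleE => // S _; have le := card_edges_cg adj S.
case: (leP _ (206 * _)) => _ /=; last by rewrite add0r lerDr.
case: (leP #|edges (cg adj S)|%:R (10 * n)) => [_|lt]; first by rewrite addr0 lerDl.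
suff -> : 10 * n < #|crossings E S|%:R by rewrite add0r addr0.
by apply: lt_le_trans lt _; rewrite ler_nat.
Qed.
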